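(* Let $G=(V,E)$ be a hedgegraph on $n$ vertices with connectivity $\lambda>0$. Let $A\subseteq E$ be obtained by including each hedge $e\in E$ independently with probability at least $\frac{20\log n}{\lambda}$. Then the sub-hedgegraph $(V,A)$ is connected with probability at least $1-2/n$.
   Context: A hedgegraph $G=(V,E)$ consists of a finite vertex set $V$ and a finite set $E$ of hedges; each hedge is a set of hyperedges (subsets of $V$), the hyperedges within one hedge are pairwise vertex-disjoint, and no hyperedge belongs to two hedges. For $A\subseteq E$, $(V,A)$ is the sub-hedgegraph with hedge set $A$; it is connected if the hypergraph on $V$ formed by all hyperedges of all hedges in $A$ is connected. For $S\subseteq V$, $\delta(S)$ is the set of hedges containing a hyperedge $h$ with $h\cap S\ne\emptyset$ and $h\setminus S\ne\emptyset$; $\lambda=\min\{|\delta(S)|:\emptyset\ne S\subsetneq V\}$. Here $\log$ is the natural logarithm; if $20\log n/\lambda\ge1$ every hedge is included. *)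

(* Defs.v *)
From HB Require Import structures.
From mathcomp Require Import all_boot all_order all_algebra.

Set Implicit Arguments.
Unset Strict Implicit.
Unset Printing Implicit Defensive.

(* A hyperedge has type {set V}, a hedge has type {set {set V}}.  The first
   [trivIset] condition says that the hyperedges within one hedge are pairwise
   vertex-disjoint; the second says that no hyperedge lies in two hedges. *)
Record hedgegraph (V : finType) := Hedgegraph {
  hedges : {set {set {set V}}};
  hedge_trivIset : forall e, e \in hedges -> trivIset e;
  hedges_trivIset : trivIset hedges
}.

Definition hyperedge_adj (V : finType) (H : {set {set V}}) : rel V :=
  fun x y => [exists h in H, (x \in h) && (y \in h)].

Definition hypergraph_connected (V : finType) (H : {set {set V}}) : Prop :=
  forall x y : V, connect (hyperedge_adj H) x y.

(* [cover A] is the set of all hyperedges of all hedges in A. *)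
Definition hedge_connected (V : finType) (A : {set {set {set V}}}) : Prop :=
  hypergraph_connected (cover A).

Definition hedge_cut (V : finType) (G : hedgegraph V) (S : {set V}) :
    {set {set {set V}}} :=
  [set e in hedges G | [exists h in e, (h :&: S != set0) && (h :\: S != set0)]].

(* The seed #|hedges G| bounds the size of every cut from above, so this is the
   exact minimum as soon as V has a nonempty proper subset, i.e. two vertices. *)
Definition connectivity (V : finType) (G : hedgegraph V) : nat :=
  \big[minn/#|hedges G|]_(S : {set V} | (S != set0) && (S \proper [set: V]))
    #|hedge_cut G S|.

From mathcomp Require Import all_classical all_reals all_analysis.

Local Open Scope classical_set_scope.
Local Open Scope ereal_scope.

(* Mutual independence of the events F i for i in J: the product rule over
   every subfamily. *)
Definition mutually_independent (d : measure_display) (T : measurableType d)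
    (R : realType) (P : probability T R) (I : finType) (J : {set I})
    (F : I -> set T) : Prop :=
  forall B : {set I}, B \subset J ->
    P (\bigcap_(i in [set` B]) F i) = \prod_(i in B) P (F i).

(* Main.v *)
Require Import Defs.
From mathcomp Require Import all_boot all_order all_algebra.
From mathcomp Require Import zify ring lra.

(** Let [X S] be the number of connected components of [(V, S)] minus one.  A
    hedge crossing the boundary of [d] components merges each of them with
    another one, so adding it removes at least [d / 2] components.  While there
    are [k > 1] components each has at least [lambda] crossing hedges, so summing
    over all hedges the loss is at least [k * lambda / 2 >= c * X S] with
    [c = lambda./2].  Double counting pairs [e \in S] turns this into
    [(m + 1) b_(m+1) <= (N - c - m) b_m] for [b_m] the sum of [X] over the sets
    of [m] out of [N] hedges, whence [b_m <= (n - 1) 'C(N - c, m)], and the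
    binomial theorem bounds the mean of [X] under uniform sampling probability
    [p] by [(n - 1) (1 - p) ^ c].  Larger probabilities only decrease the mean of
    the antitone function [X], and Markov's inequality concludes when [p < 1]; when
    [p = 1] almost surely every hedge is sampled. *)

(** * Counting points of non-trivial fibres *)

(** Fibre by fibre: a fibre of size [s >= 1] contains [b <= s] points of [B], and [b > 0] forces
    [s >= 2], so [b + 2 <= 2 * s] in either case. *)
Lemma double_card_imset_le (T U : finType) (f : T -> U) (D B : {set T}) :
  B \subset D ->
  (forall x, x \in B -> exists2 y, y \in D & (y != x) && (f y == f x)) ->
  #|B| + 2 * #|f @: D| <= 2 * #|D|.
Proof.
move=> BD hB.
have split_fibres (C : {set T}) : C \subset D ->
    #|C| = \sum_(u in f @: D) \sum_(x in C | f x == u) 1.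
  move=> CD; rewrite -sum1_card.
  rewrite (partition_big f (mem (f @: D))) //= => x xC.
  by apply: imset_f; apply: (subsetP CD).
rewrite (split_fibres B) // (split_fibres D) // -sum1_card.
rewrite !big_distrr -big_split /=; apply: leq_sum => u /imsetP[x xD ->].
rewrite !sum1_card muln1.
pose fibre (C : {set T}) := [set y in C | f y == f x].
have card_fibre (C : {set T}) : #|[pred y in C | f y == f x]| = #|fibre C|.
  by rewrite cardsE.
rewrite !card_fibre; set Bu := fibre B; set Du := fibre D.
have BDu : Bu \subset Du.
  by apply/subsetP => y; rewrite !inE => /andP[/(subsetP BD) -> ->].
have := subset_leq_card BDu.
have Du_gt0 : 0 < #|Du| by apply/card_gt0P; exists x; rewrite inE xD /=.
have [->|[y yB]] := set_0Vmem Bu; first by rewrite cards0; lia.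
suff : 1 < #|Du| by lia.
have := yB; rewrite inE => /andP[yB' /eqP fy].
have [z zD /andP[zy /eqP fz]] := hB y yB'.
apply/card_gt1P; exists z, y; split=> //; last exact: (subsetP BDu).
by rewrite inE zD fz fy /=.
Qed.

(** * Components of a sub-hedgegraph and their loss under adding hedges *)

Section Components.
Variable V : finType.
Implicit Types (S : {set {set {set V}}}) (e : {set {set V}}) (x y : V).

Definition comp_root S := fingraph.root (hyperedge_adj (cover S)).

Definition comp_roots S : {set V} := [set comp_root S x | x : V].

(** The predecessor is truncated, so the value is 0 for one component and also for an empty [V]. *)
Definition excess S := #|comp_roots S|.-1.

Lemma connect_sym_hyperedge_adj S : connect_sym (hyperedge_adj (cover S)).
Proof.
apply: sym_connect_sym => x y; apply: eq_existsb => h.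
by rewrite [(x \in h) && _]andbC.
Qed.

Lemma comp_root_eq S x y :
  (comp_root S x == comp_root S y) = connect (hyperedge_adj (cover S)) x y.
Proof. exact: root_connect (connect_sym_hyperedge_adj S) x y. Qed.

Lemma comp_root_sub S S' x y : S \subset S' ->
  comp_root S x == comp_root S y -> comp_root S' x == comp_root S' y.
Proof.
move=> /subsetP sub; rewrite !comp_root_eq; apply: connect_sub => {}x {}y.
case/existsP=> h /andP[/bigcupP[e /sub eS' he] xyh].
apply/connect1/existsP; exists h; rewrite xyh andbT.
by apply/bigcupP; exists e.
Qed.

Lemma comp_rootK S S' x : S \subset S' ->
  comp_root S' (comp_root S x) = comp_root S' x.
Proof.
move=> sub; apply/eqP/(comp_root_sub S) => //.
by rewrite /comp_root root_root //; exact: connect_sym_hyperedge_adj.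
Qed.

(** Enlarging the hedge set acts on components as a map from old roots to new ones; its fibres are
    the groups of components that get merged. *)
Lemma comp_roots_sub S S' : S \subset S' ->
  comp_roots S' = comp_root S' @: comp_roots S.
Proof.
move=> sub; rewrite /comp_roots -imset_comp.
by apply: eq_imset => x /=; rewrite comp_rootK.
Qed.

Lemma excess_anti S S' : S \subset S' -> excess S' <= excess S.
Proof.
move=> /comp_roots_sub E; rewrite /excess E.
have := leq_imset_card (comp_root S') (comp_roots S); lia.
Qed.

Lemma excess_le S : excess S <= #|V|.-1.
Proof. have := max_card (comp_roots S); rewrite /excess; lia. Qed.

Lemma hedge_connected_excess S : excess S = 0 -> hedge_connected S.
Proof.
move=> S0 x y; rewrite -comp_root_eq; apply: contra_eqT S0 => neq.
suff : 1 < #|comp_roots S| by rewrite /excess; lia.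
by apply/card_gt1P; exists (comp_root S x), (comp_root S y); split;
  rewrite ?imset_f.
Qed.

Definition comp_of S x : {set V} := [set y | comp_root S y == x].

Variable G : hedgegraph V.
Local Notation E := (hedges G).
Local Notation lambda := (connectivity G).

Lemma connectivity_le (C : {set V}) : C != set0 -> C \proper [set: V] ->
  lambda <= #|hedge_cut G C|.
Proof.
move=> C0 CT; rewrite /connectivity -minEnat.
by apply: (Order.TotalTheory.bigmin_le_cond #|hedges G|); rewrite C0.
Qed.

(** A hyperedge of [e] leaving a component joins it to the component of an outside vertex, so the
    root of a crossed component shares its fibre with another root and [double_card_imset_le]
    applies. *)
Lemma card_crossed_comps S e : e \in E ->
  #|[set x in comp_roots S | e \in hedge_cut G (comp_of S x)]|
    + 2 * #|comp_roots (e |: S)| <= 2 * #|comp_roots S|.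
Proof.
move=> eE; have sub : S \subset e |: S by exact: subsetUr.
rewrite (comp_roots_sub _ _ sub); apply: double_card_imset_le.
  by apply/subsetP => x; rewrite inE => /andP[].
move=> x; rewrite !inE => /andP[xS /andP[_ /existsP[h]]].
move=> /andP[he /andP[/set0Pn[y] + /set0Pn[z]]]; rewrite !inE.
move=> /andP[yh /eqP yx] /andP[zx zh].
exists (comp_root S z); first exact: imset_f.
rewrite zx /= -yx !comp_rootK // comp_root_eq.
apply/connect1/existsP; exists h; rewrite zh yh /= andbT.
by apply/bigcupP; exists e; rewrite ?setU11.
Qed.

(** Sum [card_crossed_comps] over all hedges and exchange the sums: each component then contributes
    the size of its own cut, which is at least [lambda]. *)
Lemma sum_comps_lost S : S \subset E -> 1 < #|comp_roots S| ->
  #|comp_roots S| * lambda + 2 * \sum_(e in E) #|comp_roots (e |: S)|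
    <= 2 * (#|E| * #|comp_roots S|).
Proof.
move=> SE k_gt1.
have -> : 2 * (#|E| * #|comp_roots S|) = \sum_(e in E) 2 * #|comp_roots S|.
  by rewrite sum_nat_const; lia.
have le : \sum_(e in E) _ <= \sum_(e in E) _ :=
  @leq_sum _ _ _ _ _ (card_crossed_comps S).
apply: leq_trans le.
rewrite big_split big_distrr /= leq_add2r.
under eq_bigr do rewrite -sum1_card big_mkcond /=.
rewrite exchange_big /=.
apply: (@leq_trans (\sum_(x in comp_roots S) #|hedge_cut G (comp_of S x)|)).
  rewrite -sum_nat_const; apply: leq_sum => x xS.
  (* A second root shows that the component of [x] is not all of [V]. *)
  have [y yS yx] : exists2 y, y \in comp_roots S & y != x.
    have /card_gt1P[y [z [yS zS yz]]] := k_gt1.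
    have [yx|] := eqVneq y x; last by exists y.
    by exists z; rewrite // -yx eq_sym.
  have /imsetP[x' _ xx'] := xS; have /imsetP[y' _ yy'] := yS.
  apply: connectivity_le; first by apply/set0Pn; exists x'; rewrite inE xx'.
  apply/properP; split; first exact: subsetT.
  by exists y'; rewrite // inE -yy'.
rewrite [leqRHS](bigID (mem (comp_roots S))) /=.
apply: leq_trans (leq_addr _ _).
apply: leq_sum => x xS; rewrite -sum1_card big_mkcond /=.
rewrite [leqRHS]big_mkcond; apply: leq_sum => e _.
by rewrite !inE xS /=; case: (e \in E).
Qed.

(** At [S = E] adding a hedge changes nothing, so two or more components would force a positive
    multiple of [lambda] below 0. *)
Lemma hedge_connected_hedges : 0 < lambda -> hedge_connected E.
Proof.
move=> l_gt0; apply: hedge_connected_excess.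
have [k1|/sum_comps_lost -/(_ (subxx _))] := leqP #|comp_roots E| 1.
  by rewrite /excess; lia.
under eq_bigr => e eE do rewrite (setUidPr _) ?sub1set //.
rewrite sum_nat_const -[leqRHS]add0n leq_add2r leqn0 muln_eq0 /excess.
by case/orP=> /eqP; lia.
Qed.

(** Hedges already in [S] lose no component, so the loss in [sum_comps_lost] comes from [E :\: S]
    alone. *)
Lemma excess_add_hedge S : S \subset E ->
  \sum_(e in E :\: S) excess (e |: S) <= (#|E :\: S| - lambda./2) * excess S.
Proof.
move=> SE; have [k1|k_gt1] := leqP #|comp_roots S| 1.
  rewrite big1 // => e _; have := excess_anti S (e |: S) (subsetUr _ _).
  by rewrite /excess; lia.
have := sum_comps_lost S SE k_gt1.
rewrite (big_setID S) /= (setIidPr SE).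
under eq_bigr => e eS do rewrite (setUidPr _) ?sub1set //.
rewrite sum_nat_const.
have -> : \sum_(e in E :\: S) #|comp_roots (e |: S)|
    = \sum_(e in E :\: S) excess (e |: S) + #|E :\: S|.
  rewrite -[#|_ :\: S|]sum1_card -big_split /=; apply: eq_bigr => e _.
  rewrite /excess addn1 prednK //; apply/card_gt0P.
  have /card_gt0P[x _] := ltnW k_gt1.
  by exists (comp_root (e |: S) x); exact: imset_f.
have := cardsID S E; rewrite (setIidPr SE).
move=> <-; rewrite /excess; case: #|comp_roots S| k_gt1 => // j _ /=.
move: (\sum_(_ in _) _) #|E :\: S| => s r.
(* With [c = lambda./2], [j] the excess of [S], [r] the number of new hedges and [s] the sum on the
   left, the facts amount to [c * j.+1 + s <= r * j]. This also excludes [r < c], where [r - c]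
   would be truncated. *)
have : j.+1 * (2 * lambda./2) <= j.+1 * lambda by rewrite leq_mul2l; lia.
by move: lambda./2 lambda #|S| => c l m; nia.
Qed.

Definition excess_level m := \sum_(S in powerset E | #|S| == m) excess S.

(** A set [S'] of size [m.+1] with a chosen [e \in S'] is the same datum as a set [S = S' :\ e] of
    size [m] with a new hedge [e]; [excess_add_hedge] bounds the sum over [e] for each [S]. *)
Lemma excess_levelS m :
  m.+1 * excess_level m.+1 <= (#|E| - lambda./2 - m) * excess_level m.
Proof.
have -> : m.+1 * excess_level m.+1
    = \sum_(S in powerset E | #|S| == m.+1) \sum_(e in S) excess S.
  rewrite /excess_level big_distrr /=; apply: eq_bigr => S /andP[_ /eqP <-].
  by rewrite sum_nat_const.
have -> : \sum_(S in powerset E | #|S| == m.+1) \sum_(e in S) excess S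
    = \sum_(S in powerset E | #|S| == m) \sum_(e in E :\: S) excess (e |: S).
  rewrite !pair_big_dep /=.
  rewrite (reindex_onto
     (fun p : {set {set {set V}}} * {set {set V}} => (p.2 |: p.1, p.2))
     (fun p => (p.1 :\ p.2, p.2))) /=; last first.
    by case=> S e /= /andP[_ eS]; rewrite setD1K.
  (* If [e \in S], the round trip [(e |: S) :\ e] does not return [S], so such pairs are absent from
     both sums. *)
  apply: eq_bigl => -[S e] /=; rewrite !inE xpair_eqE eqxx !andbT /=.
  rewrite subUset sub1set; have [eS|eS] := boolP (e \in S).
    rewrite !andbF; apply/negbTE; rewrite negb_and orbC.
    by apply/orP; left; apply: contraTneq eS => <-; rewrite setD11.
  rewrite cardsU1 eS setU1K // eqxx !andbT add1n eqSS.
  by rewrite -andbA [RHS]andbC andbA.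
rewrite /excess_level big_distrr /=; apply: leq_sum => S /andP[].
rewrite inE => SE /eqP Sm; apply: leq_trans (excess_add_hedge S SE) _.
rewrite -subnDA [_./2 + m]addnC subnDA leq_mul2r.
by rewrite cardsD (setIidPr SE) Sm leqnn orbT.
Qed.

(** The binomial coefficients satisfy the recurrence of [excess_levelS] with equality
    ([mul_bin_left]). *)
Lemma excess_level_le m : excess_level m <= #|V|.-1 * 'C(#|E| - lambda./2, m).
Proof.
elim: m => [|m IH].
  rewrite bin0 muln1 /excess_level (big_pred1 set0); first exact: excess_le.
  move=> S; rewrite inE cards_eq0 andbC /=.
  by case: eqP => [->|] //=; rewrite sub0set.
rewrite -(leq_pmul2l (ltn0Sn m)); apply: leq_trans (excess_levelS m) _.
rewrite mulnCA mul_bin_left mulnCA; exact: leq_mul.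
Qed.

End Components.

Import Order.TTheory GRing.Theory Num.Theory.
Local Open Scope ring_scope.

(** * Finite product distributions on subsets *)

Section IndependentSampling.
Variables (R : realFieldType) (I : finType).
Implicit Types (w : I -> R) (J S : {set I}) (X Y : {set I} -> R) (p : R).

(** The probability that the sample is exactly [S] when each [i] in [J] is kept independently with
    probability [w i]. *)
Definition sample_weight w J S : R :=
  \prod_(i in J) (if i \in S then w i else 1 - w i).

Definition sample_mean w J X : R :=
  \sum_(S in powerset J) sample_weight w J S * X S.

Lemma sample_weight_ge0 w J S : (forall i, i \in J -> 0 <= w i <= 1) ->
  0 <= sample_weight w J S.
Proof.
move=> w01; apply: prodr_ge0 => i /w01 /andP[w0 w1].
by case: ifP => _ //; rewrite subr_ge0.
Qed.

Lemma sample_mean_le w J X Y : (forall i, i \in J -> 0 <= w i <= 1) ->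
  (forall S, S \subset J -> X S <= Y S) ->
  sample_mean w J X <= sample_mean w J Y.
Proof.
move=> w01 XY; apply: ler_sum => S; rewrite inE => SJ.
by apply: ler_wpM2l; [exact: sample_weight_ge0 | exact: XY].
Qed.

(** Conditions on whether [i] is kept. *)
Lemma sample_mean_setU1 w J X i : i \notin J ->
  sample_mean w (i |: J) X
    = sample_mean w J (fun S => (1 - w i) * X S + w i * X (i |: S)).
Proof.
move=> iJ; rewrite /sample_mean (bigID (fun S => i \in S)) /= addrC.
have notin S : S \subset J -> i \notin S.
  by move=> SJ; apply: contra iJ; exact: (subsetP SJ).
have -> : \sum_(S in powerset (i |: J) | i \notin S)
      sample_weight w (i |: J) S * X S
    = \sum_(S in powerset J) sample_weight w J S * ((1 - w i) * X S).
  apply: eq_big => [S|S /andP[_ iS]].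
    rewrite !inE; apply/andP/idP => [[SJ iS]|SJ]; last first.
      by rewrite notin //; split => //; apply: subset_trans SJ (subsetUr _ _).
    apply/subsetP => j jS; have := subsetP SJ j jS; rewrite !inE.
    by case: eqP jS => // ->; rewrite (negbTE iS).
  by rewrite /sample_weight big_setU1 //= (negbTE iS) mulrA [_ * (1 - _)]mulrC.
have -> : \sum_(S in powerset (i |: J) | i \in S)
      sample_weight w (i |: J) S * X S
    = \sum_(S in powerset J) sample_weight w J S * (w i * X (i |: S)).
  rewrite (reindex_onto (fun S => i |: S) (fun S => S :\ i)) /=; last first.
    by move=> S /andP[_ iS]; rewrite setD1K.
  apply: eq_big => [S|S /andP[/andP[_ _] /eqP SE]].
    rewrite !inE eqxx /= andbT; apply/andP/idP => [[SJ /eqP SE]|SJ].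
      apply/subsetP => j jS; have iS : i \notin S by rewrite -SE setD11.
      have := subsetP SJ j; rewrite !inE jS orbT => /(_ isT).
      by case: eqP jS => // ->; rewrite (negbTE iS).
    by rewrite setUS // setU1K // notin.
  rewrite /sample_weight big_setU1 //= setU11.
  rewrite (eq_bigr (fun j => if j \in S then w j else 1 - w j)); first by ring.
  by move=> j jJ; rewrite !inE; case: eqP jJ => // ->; rewrite (negbTE iJ).
by rewrite -big_split /=; apply: eq_bigr => S _; rewrite mulrDr.
Qed.

(** Lower the weights to [p] one element at a time: keeping [i] less often can only raise the mean
    of an antitone [X]. *)
Lemma sample_mean_anti w p J X : 0 <= p ->
  (forall i, i \in J -> p <= w i <= 1) ->
  (forall S S', S \subset S' -> X S' <= X S) ->
  sample_mean w J X <= sample_mean (fun=> p) J X.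
Proof.
move=> p0; have [n] := ubnP #|J|; elim: n => // n IH in J X *.
have [->|[i iJ]] := set_0Vmem J.
  move=> _ _ _; rewrite /sample_mean powerset0 !big_set1.
  by rewrite /sample_weight !big_set0.
rewrite (cardsD1 i) iJ ltnS => Jn wp antiX.
have w01 j : j \in J -> 0 <= w j <= 1.
  by move=> /wp /andP[/(le_trans p0) -> ->].
have /andP[pwi wi1] := wp i iJ; have p1 := le_trans pwi wi1.
rewrite -(setD1K iJ) !sample_mean_setU1 ?setD11 //.
(* Intermediate distribution: [i] already has weight [p], the others still have [w]. *)
apply: le_trans (_ : sample_mean w (J :\ i)
   (fun S => (1 - p) * X S + p * X (i |: S)) <= _).
  apply: sample_mean_le => [j|S _]; first by rewrite !inE => /andP[_ /w01].
  have := antiX S (i |: S) (subsetUr _ _); nra.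
apply: IH => //.
  by move=> j; rewrite !inE => /andP[_ /wp].
(* The mixture over the choice for [i] is again antitone, as the induction hypothesis requires. *)
move=> S S' SS'; apply: lerD; apply: ler_wpM2l; rewrite ?subr_ge0 //.
  exact: antiX.
by apply: antiX; exact: setUS.
Qed.

Lemma sample_mean_const p J X :
  sample_mean (fun=> p) J X = \sum_(m < #|J|.+1)
    p ^+ m * (1 - p) ^+ (#|J| - m) * \sum_(S in powerset J | #|S| == m) X S.
Proof.
rewrite /sample_mean.
rewrite (partition_big (fun S => inord #|S| : 'I_#|J|.+1) xpredT) //=.
apply: eq_bigr => m _; rewrite big_distrr /=.
apply: eq_big => [S|S /andP[]].
  rewrite inE; case SJ: (S \subset J) => //=.
  by rewrite -val_eqE /= inordK // ltnS subset_leq_card.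
rewrite inE => SJ /eqP <-; rewrite inordK ?ltnS ?subset_leq_card //.
congr (_ * _); rewrite /sample_weight (big_setID S) /= (setIidPr SJ).
under eq_bigr => i iS do rewrite iS.
rewrite prodr_const; congr (_ * _).
under eq_bigr => i iS do [move: iS; rewrite inE => /andP[/negbTE -> _]].
by rewrite prodr_const cardsD (setIidPr SJ).
Qed.

End IndependentSampling.

(** Grouping by size and [excess_level_le] leave a sum of ['C(N - c, m)] terms; pulling out
    [(1 - p) ^+ c] makes it the expansion of [(1 - p + p) ^+ (N - c)]. *)
Lemma sample_mean_excess_le (R : realFieldType) (V : finType)
    (G : hedgegraph V) (p : R) : 0 <= p <= 1 ->
  sample_mean R _ (fun=> p) (hedges G) (fun S => (excess V S)%:R)
    <= #|V|.-1%:R * (1 - p) ^+ (connectivity G)./2.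
Proof.
case/andP=> p0 p1; have q0 : 0 <= 1 - p by rewrite subr_ge0.
rewrite sample_mean_const; set N := #|hedges G|; set c := (connectivity G)./2.
(* The seed of the minimum gives [connectivity G <= N]; hence [N - m] splits as [c + (N - c - m)]
   for [m <= N - c]. *)
have cN : (c <= N)%N.
  have : (connectivity G <= N)%N.
    by rewrite /connectivity -minEnat; exact: (bigmin_le_id (T := nat)).
  rewrite /c; lia.
have binomial_sum : \sum_(m < N.+1)
     p ^+ m * (1 - p) ^+ (N - m) * ('C(N - c, m))%:R = (1 - p) ^+ c.
  have -> : (1 - p) ^+ c = (1 - p) ^+ c * (1 - p + p) ^+ (N - c).
    by rewrite subrK expr1n mulr1.
  rewrite [(_ + p) ^+ _]exprDn mulr_sumr.
  rewrite (big_ord_widen N.+1 (fun m => (1 - p) ^+ c *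
    ((1 - p) ^+ (N - c - m) * p ^+ m *+ 'C(N - c, m)))); last first.
    by rewrite ltnS leq_subr.
  (* Indices [m > N - c] contribute nothing, since their binomial coefficient is 0. *)
  rewrite [RHS]big_mkcond /=; apply: eq_bigr => m _; case: ifP => mc.
    rewrite -[in RHS]mulr_natr !mulrA; congr (_ * _).
    rewrite mulrC -exprD; congr (_ ^+ _ * _); move: mc; lia.
  by rewrite bin_small ?mulr0 //; move: mc; lia.
rewrite -binomial_sum big_distrr /=; apply: ler_sum => m _.
rewrite mulrCA; apply: ler_wpM2l; first by rewrite mulr_ge0 ?exprn_ge0.
by rewrite -natr_sum -natrM ler_nat; exact: excess_level_le.
Qed.

From mathcomp Require Import all_classical all_reals all_analysis.

Local Open Scope classical_set_scope.
Local Open Scope ring_scope.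

(** * Union bound and probabilities of exact outcomes *)

Lemma measure_bigsetU_le (d : measure_display) (T : measurableType d)
    (R : realType) (mu : {measure set T -> \bar R}) (I : Type) (r : seq I)
    (Q : pred I) (F : I -> set T) :
  (forall i, Q i -> measurable (F i)) ->
  (mu (\big[setU/set0]_(i <- r | Q i) F i) <= \sum_(i <- r | Q i) mu (F i))%E.
Proof.
move=> mF; elim: r => [|i r IH]; first by rewrite !big_nil measure0.
rewrite !big_cons; case: ifP => // Qi.
apply: le_trans (measureU2 _ _ _) _; [exact: mF| |exact: leeD].
exact: bigsetU_measurable.
Qed.

Section IndependentEvents.
Context (d : measure_display) (T : measurableType d) (R : realType)
  (P : probability T R) (I : finType) (J : {set I}) (F : I -> set T).
Hypothesis F_meas : forall i, i \in J -> measurable (F i).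
Hypothesis F_indep : mutually_independent P J F.

(** [B] and [K] need not exhaust [J], so an induction can move one index at a time; [K = J :\: B]
    gives the event that precisely the indices of [B] occur. *)
Definition in_out_event (B K : {set I}) : set T :=
  \bigcap_(i in [set` B]) F i `&` \bigcap_(i in [set` K]) ~` F i.

Lemma measurable_in_out_event (B K : {set I}) : B \subset J -> K \subset J ->
  measurable (in_out_event B K).
Proof.
move=> BJ KJ; apply: measurableI; apply: fin_bigcap_measurable => // i /= iS.
  by apply: F_meas; exact: (fintype.subsetP BJ).
by apply: measurableC; apply: F_meas; exact: (fintype.subsetP KJ).
Qed.

(** Independence is a product rule for occurrences only. Complements come by induction on [K]: the
    event for [B], [K] is that for [B], [K :\ k] minus that for [k |: B], [K :\ k]. *)
Lemma probability_in_out_event (B K : {set I}) :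
  B \subset J -> K \subset J -> [disjoint B & K]%B ->
  P (in_out_event B K)
    = ((\prod_(i in B) fine (P (F i)))
       * \prod_(i in K) (1 - fine (P (F i))))%:E.
Proof.
have [n] := ubnP #|K|; elim: n => // n IH in B K *.
have [->|[k kK]] := set_0Vmem K.
  move=> _ BJ _ _; rewrite big_set0 mulr1 /in_out_event.
  have -> : [set` (finset.set0 : {set I})] = set0.
    by apply/seteqP; split => i //=; rewrite finset.in_set0.
  rewrite bigcap_set0 setIT F_indep // -prodEFin; apply: eq_bigr => i iB.
  rewrite fineK //; apply: fin_num_measure; apply: F_meas.
  exact: (fintype.subsetP BJ).
rewrite (cardsD1 k) kK ltnS => Kn BJ KJ BK.
have kJ : k \in J := fintype.subsetP KJ _ kK.
have kB : k \notin B by rewrite disjoint_sym in BK; rewrite (disjointFr BK).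
have K'J : K :\ k \subset J := fintype.subset_trans (finset.subD1set _ _) KJ.
have B'J : k |: B \subset J by rewrite finset.subUset finset.sub1set kJ.
have BK' : [disjoint B & K :\ k]%B := disjointWr (finset.subD1set _ _) BK.
have -> : in_out_event B K = in_out_event B (K :\ k) `\` F k.
  apply/seteqP; split=> w.
    move=> [wB wK]; split; last exact: wK.
    by split=> // i /=; rewrite !inE => /andP[_ iK]; exact: wK.
  move=> [[wB wK] wk]; split=> // i /= iK.
  by have [->//|ik] := eqVneq i k; apply: wK; rewrite /= !inE ik.
have mB := measurable_in_out_event _ _ BJ K'J.
have -> : P (in_out_event B (K :\ k) `\` F k) =
    (P (in_out_event B (K :\ k)) - P (in_out_event B (K :\ k) `&` F k))%E.
  rewrite measureD //; first exact: F_meas.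
  by apply: (@le_lt_trans _ _ 1%E); [exact: probability_le1 | rewrite ltry].
have -> : in_out_event B (K :\ k) `&` F k = in_out_event (k |: B) (K :\ k).
  apply/seteqP; split=> w.
    move=> [[wB wK] wk]; split=> // i /=; rewrite !inE.
    by case/orP=> [/eqP->//|]; exact: wB.
  move=> [wB wK]; split; last by apply: wB; rewrite /= !inE eqxx.
  by split=> // i iB; apply: wB; rewrite /= !inE orbC (_ : i \in B).
rewrite !IH //; last first.
  rewrite -finset.setI_eq0 finset.setIUl finset.setU_eq0 !finset.setI_eq0.
  by rewrite BK' andbT disjoints1 setD11.
rewrite -EFinB; congr (_%:E).
by rewrite (big_setD1 k kK) /= big_setU1 //=; ring.
Qed.

Lemma probability_exact_event (S : {set I}) : S \subset J ->
  P (in_out_event S (J :\: S))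
    = (sample_weight R I (fun i => fine (P (F i))) J S)%:E.
Proof.
move=> SJ; rewrite probability_in_out_event ?finset.subsetDl //; last first.
  by rewrite -finset.setI_eq0 finset.setIDA finset.setIC
    -finset.setIDA finset.setDv finset.setI0.
rewrite /sample_weight [in RHS](big_setID S) /= (finset.setIidPr SJ).
congr ((_ * _)%:E); apply: eq_bigr => i; first by move=> ->.
by rewrite inE => /andP[/negbTE ->].
Qed.

End IndependentEvents.

(** * Random subsets and Markov's inequality *)

Section RandomSubset.
Context (d : measure_display) (T : measurableType d) (R : realType)
  (P : probability T R) (I : finType) (J : {set I}) (A : T -> {set I}).
Hypothesis A_sub : forall w, A w \subset J.
Let F i : set T := [set w | i \in A w].
Hypothesis A_meas : forall i, i \in J -> measurable (F i).
Hypothesis A_indep : mutually_independent P J F.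

Lemma exact_eventE (S : {set I}) : S \subset J ->
  in_out_event d T I F S (J :\: S) = [set w | A w = S].
Proof.
move=> SJ; apply/seteqP; split=> w.
  move=> [wS wJS] /=; apply/setP => i; apply/idP/idP => [iA|]; last exact: wS.
  case iS : (i \in S) => //; have := wJS i.
  by rewrite /= inE iS (fintype.subsetP (A_sub w) i iA) => /(_ isT); case.
move=> /= <-; split=> i //=.
by rewrite inE => /andP[/negP].
Qed.

(** Writing the failure of [Q] as a finite union of exact outcomes yields both measurability for
    arbitrary [Q] and a union bound. *)
Lemma eventC_bigsetU (Q : {set I} -> Prop) :
  ~` [set w | Q (A w)] = \big[setU/set0]_(S in powerset J | ~~ `[< Q S >])
    in_out_event d T I F S (J :\: S).
Proof.
rewrite -bigcup_seq_cond; apply/seteqP; split=> w /=.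
  move=> nQ; exists (A w); last by rewrite exact_eventE.
  by rewrite /= mem_index_enum inE A_sub; apply/asboolPn.
case=> S /= /andP[_ /andP[]]; rewrite inE => SJ /asboolPn nQ.
by rewrite exact_eventE // => ->.
Qed.

Lemma measurable_random_subset (Q : {set I} -> Prop) :
  measurable [set w | Q (A w)].
Proof.
rewrite -[X in measurable X]setCK eventC_bigsetU; apply: measurableC.
apply: bigsetU_measurable => S /andP[]; rewrite inE => SJ _.
by apply: (measurable_in_out_event d T I J) => //; exact: finset.subsetDl.
Qed.

(** Markov's inequality: each outcome violating [Q] has weight at most its weight times [X], and the
    remaining terms of the mean are nonnegative. *)
Lemma probability_random_subset_ge (Q : {set I} -> Prop) (X : {set I} -> R) :
  (forall S, 0 <= X S) -> (forall S, ~ Q S -> 1 <= X S) ->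
  ((1 - sample_mean R I (fun i => fine (P (F i))) J X)%:E
    <= P [set w | Q (A w)])%E.
Proof.
move=> X0 X1; rewrite -[X in P X]setCK probability_setC; last first.
  by apply: measurableC; exact: measurable_random_subset.
rewrite EFinB; apply: leeB => //; rewrite eventC_bigsetU.
have atom_meas (S : {set I}) : S \subset J ->
    measurable (in_out_event d T I F S (J :\: S)).
  move=> SJ; apply: (measurable_in_out_event d T I J) => //.
  exact: finset.subsetDl.
apply: (@le_trans _ _ (\sum_(S in powerset J | ~~ `[< Q S >])
    P (in_out_event d T I F S (J :\: S)))%E).
  apply: measure_bigsetU_le => S /andP[]; rewrite inE => SJ _.
  exact: atom_meas.
have w01 i : i \in J -> 0 <= fine (P (F i)) <= 1.
  move=> iJ; have mF := A_meas _ iJ.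
  rewrite fine_ge0 //= -lee_fin fineK ?fin_num_measure //.
  exact: probability_le1.
rewrite /sample_mean -sumEFin.
rewrite [leRHS](bigID (fun S => ~~ `[< Q S >])) /=.
rewrite -[leLHS]adde0; apply: leeD; last first.
  apply: sume_ge0 => S _; rewrite lee_fin mulr_ge0 //.
  exact: sample_weight_ge0.
apply: lee_sum => S /andP[]; rewrite inE => SJ /asboolPn /X1 XS.
rewrite probability_exact_event // lee_fin ler_peMr //.
exact: sample_weight_ge0.
Qed.

End RandomSubset.

(** * Numerical estimate *)

(** Since [1 - p <= expR (- p)] and [l./2 >= l / 3], the exponent [p * l./2] is at least
    [20 / 3 * ln n >= 2 * ln n]; the power is then at most [n ^- 2]. *)
Lemma disconnection_bound (R : realType) (n l : nat) :
  let p : R := 20 * ln n%:R / l%:R in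
  (1 < n)%N -> (0 < l)%N -> p < 1 -> n.-1%:R * (1 - p) ^+ l./2 <= 2 / n%:R.
Proof.
move=> p n1 l0 p1; have n2 : 2 <= n%:R :> R by rewrite ler_nat.
have lR : 0 < l%:R :> R by rewrite ltr0n.
(* From [ln (1 + x) <= x] at [x = 1 / n - 1]. *)
have ln_ge : 1 / 2 <= ln (n%:R : R).
  have -> : ln (n%:R : R) = - ln (1 + (n%:R^-1 - 1)).
    by rewrite addrCA subrr addr0 lnV ?opprK // posrE; lra.
  have ninv_gt0 : 0 < n%:R^-1 :> R by rewrite invr_gt0; lra.
  have ninv_le : n%:R^-1 <= 2^-1 :> R by rewrite lef_pV2 ?posrE; lra.
  have := @le_ln1Dx R (n%:R^-1 - 1); lra.
have pl : p * l%:R = 20 * ln n%:R by rewrite divfK // gt_eqF.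
(* [p < 1] gives [l > 20 * ln n >= 10]; excluding [l = 1] is what makes [l <= 3 * l./2] true. *)
have l_gt1 : (1 < l)%N by rewrite -(ltr_nat R); nra.
have half_ge : l%:R <= 3 * l./2%:R :> R by rewrite -natrM ler_nat; lia.
have p0 : 0 <= p by apply: divr_ge0; [lra | exact: ltW].
have pow_le : (1 - p) ^+ l./2 <= (n%:R ^- 2 : R).
  apply: (@le_trans _ _ (expR (- p) ^+ l./2)).
    apply: lerXn2r; rewrite ?nnegrE ?expR_ge0 ?expR_ge1Dx //.
    by rewrite subr_ge0 ltW.
  have n0 : 0 < n%:R :> R by lra.
  rewrite -expRM_natl -[leRHS]lnK ?posrE ?invr_gt0 ?exprn_gt0 //.
  rewrite ler_expR lnV ?posrE ?exprn_gt0 // lnXn // -mulr_natl; nra.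
have n1R : n.-1%:R <= n%:R :> R by rewrite ler_nat leq_pred.
apply: (@le_trans _ _ (n%:R * n%:R ^- 2)).
  by apply: ler_pM => //; apply: exprn_ge0; rewrite subr_ge0 ltW.
rewrite expr2 invfM mulrA divff ?mul1r; last by rewrite gt_eqF //; lra.
by rewrite ler_peMl ?invr_ge0; lra.
Qed.

(** * Connectivity of the random sub-hedgegraph *)

Theorem theorem1p8 (R : realType) (V : finType) (G : hedgegraph V)
    (lambda_gt0 : (0 < connectivity G)%N)
    (d : measure_display) (T : measurableType d) (P : probability T R)
    (A : T -> {set {set {set V}}})
    (A_sub : forall w : T, A w \subset hedges G)
    (A_meas : forall e : {set {set V}},
      e \in hedges G -> measurable [set w : T | e \in A w])
    (A_indep : mutually_independent P (hedges G)
      (fun e => [set w : T | e \in A w]))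
    (A_prob : forall e : {set {set V}}, e \in hedges G ->
      ((Num.min 1 (20 * ln (#|V|%:R : R) / (connectivity G)%:R))%:E
        <= P [set w : T | e \in A w])%E) :
  ((1 - 2 / #|V|%:R)%:E <= P [set w : T | hedge_connected (A w)])%E.
Proof.
(* This covers an empty [V] too, as division by 0 gives 0. *)
have le1 : 1 - 2 / #|V|%:R <= 1 :> R.
  by rewrite lerBlDr lerDl divr_ge0.
have [V1|V_gt1] := leqP #|V| 1.
  have -> : [set w | hedge_connected (A w)] = setT.
    apply/seteqP; split=> // w _ x y.
    by have /fintype_le1P/(_ x) -> := V1.
  by rewrite probability_setT lee_fin.
have mconn := measurable_random_subset _ _ _ _ _ A_sub A_meas
  (@hedge_connected V).
have P_le1 e : e \in hedges G -> (P [set w : T | e \in A w] <= 1)%E.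
  by move=> /A_meas; exact: probability_le1.
move: A_prob; set p : R := 20 * _ / _ => A_prob.
have [p_ge1|p_lt1] := leP 1 p.
  apply: (@le_trans _ _ 1%E); first by rewrite lee_fin.
  (* Each event has probability 1, so by the product rule all hedges are kept almost surely; the
     full hedgegraph is connected because [lambda > 0]. *)
  have <- : P (\bigcap_(e in [set` hedges G]) [set w | e \in A w]) = 1%E.
    rewrite A_indep // big1 // => e eG; apply/eqP; rewrite eq_le P_le1 //=.
    by apply: le_trans (A_prob e eG); rewrite min_l.
  apply: le_measure; rewrite ?inE //.
    by apply: fin_bigcap_measurable.
  move=> w wG /=; suff -> : A w = hedges G by exact: hedge_connected_hedges.
  by apply/eqP; rewrite finset.eqEsubset A_sub; apply/fintype.subsetP => e /wG.
(* Markov's inequality with [X = excess], which is at least 1 on every disconnected outcome. *)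
apply: le_trans (probability_random_subset_ge _ _ _ _ _ _ _ A_sub A_meas
  A_indep _ (fun S => (excess V S)%:R) _ _) => //; last first.
  move=> S nS; rewrite ler1n lt0n; apply/eqP => S0.
  by apply: nS; exact: hedge_connected_excess.
have p_ge0 : 0 <= p.
  apply: divr_ge0 => //; apply: mulr_ge0 => //; apply: ln_ge0.
  by rewrite ler1n ltnW.
rewrite lee_fin lerD2l lerN2.
(* The chain is built from its right end: numerical estimate, mean at uniform probability [p], then
   comparison of the actual probabilities with [p]. *)
apply: le_trans (disconnection_bound R _ _ V_gt1 lambda_gt0 p_lt1).
apply: le_trans (sample_mean_excess_le _ _ _ _ _); last by rewrite p_ge0 ltW.
apply: sample_mean_anti => // [e eG|S S' SS'].
  have finP := fin_num_measure P _ (A_meas e eG).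
  rewrite -!lee_fin fineK // P_le1 // andbT.
  by apply: le_trans (A_prob e eG); rewrite min_r // ltW.
by rewrite ler_nat excess_anti.
Qed.
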